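(* The Banach algebra $C(X)'_1$ is hermitian (every self-adjoint element has real spectrum) and semisimple.
   Context: Let $X$ be a non-empty compact Hausdorff space and $\sigma:X\to X$ a homeomorphism. $C(X)$ is the algebra of continuous complex functions on $X$ with sup norm $\|\cdot\|_\infty$, and $\alpha(f)=f\circ\sigma^{-1}$. $\ell^1(\Sigma)$ is the set of maps $\ell:\mathbb{Z}\to C(X)$ with $\|\ell\|=\sum_k\|\ell(k)\|_\infty<\infty$, with product $(\ell\ell')(n)=\sum_k\ell(k)\,\alpha^k(\ell'(n-k))$ and involution $\ell^*(n)=\overline{\alpha^n(\ell(-n))}$; it is a unital Banach $*$-algebra, in which $C(X)$ is embedded as the functions supported at $0\in\mathbb{Z}$. $C(X)'_1$ denotes the commutant of $C(X)$ in $\ell^1(\Sigma)$ (a commutative closed unital $*$-subalgebra), with the norm and involution of $\ell^1(\Sigma)$. *)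

(* Defs.v *)
From HB Require Import structures.
From mathcomp Require Import all_boot all_order all_algebra.
From mathcomp Require Import all_classical all_reals all_analysis.
From mathcomp Require Import complex.

Set Implicit Arguments.
Unset Strict Implicit.
Unset Printing Implicit Defensive.
Import Order.TTheory GRing.Theory Num.Theory.
Import numFieldNormedType.Exports.
Local Open Scope classical_set_scope.
Local Open Scope ring_scope.

Section L1Sigma.
Variables (R : realType) (X : topologicalType).

Definition cnorm (z : R[i]) : R :=
  Num.sqrt (complex.Re z ^+ 2 + complex.Im z ^+ 2).

Definition ccontinuous (f : X -> R[i]) : Prop :=
  continuous (fun x : X => (complex.Re (f x) : R)) /\
  continuous (fun x : X => (complex.Im (f x) : R)).

Definition supnorm (f : X -> R[i]) : R := sup [set cnorm (f x) | x in [set: X]].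

Definition zpartial (u : int -> R) (N : nat) : R :=
  \sum_(i < N.*2) u (i%:Z - N%:Z).

Definition zsumR (u : int -> R) : R := limn (zpartial u).

(** sum over Z of a (absolutely summable) complex family *)
Definition zsumC (u : int -> R[i]) : R[i] :=
  Complex (zsumR (fun k => complex.Re (u k))) (zsumR (fun k => complex.Im (u k))).

Definition elt := int -> X -> R[i].

Definition in_l1 (a : elt) : Prop :=
  (forall k, ccontinuous (a k)) /\
  exists M : R, forall N, zpartial (fun k => supnorm (a k)) N <= M.

Variables (s si : X -> X). (* sigma and its inverse *)

Definition zit (k : int) : X -> X :=
  match k with Posz n => iter n s | Negz n => iter n.+1 si end.

Definition alphak (k : int) (f : X -> R[i]) : X -> R[i] := fun x => f (zit (- k) x).

Definition l1mul (a b : elt) : elt :=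
  fun n x => zsumC (fun k => a k x * alphak k (b (n - k)) x).

Definition l1star (a : elt) : elt := fun n x => conjc (alphak n (a (- n)) x).

Definition l1one : elt := fun n _ => if n == 0 then 1 else 0.
Definition l1zero : elt := fun _ _ => 0.

Definition l1emb (f : X -> R[i]) : elt := fun n x => if n == 0 then f x else 0.

Definition l1subsc (a : elt) (l : R[i]) : elt := fun n x => a n x - l * l1one n x.

Definition commutant (a : elt) : Prop :=
  in_l1 a /\ forall f, ccontinuous f -> l1mul a (l1emb f) = l1mul (l1emb f) a.

Definition comm_invertible (a : elt) : Prop :=
  exists b, commutant b /\ l1mul a b = l1one /\ l1mul b a = l1one.

Definition comm_spectrum (a : elt) : set R[i] :=
  [set l | ~ comm_invertible (l1subsc a l)].

Definition hermitian_comm : Prop :=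
  forall a, commutant a -> l1star a = a ->
  forall l, comm_spectrum a l -> complex.Im l = 0.

Definition comm_proper_ideal (I : set elt) : Prop :=
  I `<=` commutant /\ I l1zero /\
  (forall a b, I a -> I b -> I (fun n x => a n x + b n x)) /\
  (forall a b, I a -> commutant b -> I (l1mul b a) /\ I (l1mul a b)) /\
  ~ I l1one.

Definition comm_maximal_ideal (I : set elt) : Prop :=
  comm_proper_ideal I /\ forall J, comm_proper_ideal J -> I `<=` J -> J = I.

Definition comm_radical : set elt :=
  [set a | commutant a /\ forall I, comm_maximal_ideal I -> I a].

Definition semisimple_comm : Prop := comm_radical `<=` [set l1zero].

End L1Sigma.

(* Main.v *)
(** Coefficients of an element of the commutant are supported on fixed points:
    [a n x != 0] forces [sigma^n x = x] (separate points by Urysohn), so on the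
    commutant the twisted product is pointwise convolution in [l^1(Z)] and
    [a |-> gelfand a x z = \sum_n a n x * z ^ n] with [|z| = 1] is multiplicative.
    Averaging over roots of unity bounds each coefficient by the sup norm of
    [gelfand a]; hence these characters separate the commutant, and their kernels
    are maximal ideals, which gives semisimplicity.  The same bound applied to
    powers of an element with finitely many nonzero coefficients shows that their
    norms grow like a polynomial times the powers of the sup norm; by density,
    [1 - c] is invertible as soon as [|gelfand c| <= rho < 1].  A self-adjoint
    [a] has a real transform, so for [l] not real its values lie in a disc
    avoiding [l], and [a - l] is a scalar multiple of such a [1 - c]. *)

Require Import Defs.
From HB Require Import structures.
From mathcomp Require Import all_boot all_order all_algebra.
From mathcomp Require Import all_classical all_reals all_analysis.
From mathcomp Require Import complex.
From mathcomp Require Import cyclic separable cyclotomic ring lra zify.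

Set Implicit Arguments.
Unset Strict Implicit.
Unset Printing Implicit Defensive.
Import Order.TTheory GRing.Theory Num.Theory.
Import numFieldNormedType.Exports.
Local Open Scope classical_set_scope.

(** * The real-valued modulus on the complex numbers *)

Section ComplexNorm.
Variable R : realType.
Local Open Scope ring_scope.
Implicit Types (z w : R[i]).

Lemma cnormE z : (cnorm z)%:C%C = `|z|.
Proof. by rewrite normc_def. Qed.

Lemma cnorm_ge0 z : 0 <= cnorm z.
Proof. exact: sqrtr_ge0. Qed.

Lemma cnormM z w : cnorm (z * w) = cnorm z * cnorm w.
Proof. by apply: (@complexI R); rewrite cnormE rmorphM /= !cnormE normrM. Qed.

Lemma cnormD z w : cnorm (z + w) <= cnorm z + cnorm w.
Proof. by rewrite -lecR rmorphD /= !cnormE ler_normD. Qed.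

Lemma cnormN z : cnorm (- z) = cnorm z.
Proof. by apply: (@complexI R); rewrite !cnormE normrN. Qed.

Lemma cnormV z : cnorm z^-1 = (cnorm z)^-1.
Proof. by apply: (@complexI R); rewrite fmorphV /= !cnormE normfV. Qed.

Lemma cnorm0 : cnorm (0 : R[i]) = 0.
Proof. by apply: (@complexI R); rewrite cnormE normr0. Qed.

Lemma cnorm1 : cnorm (1 : R[i]) = 1.
Proof. by apply: (@complexI R); rewrite cnormE normr1. Qed.

Lemma cnormX z n : cnorm (z ^+ n) = cnorm z ^+ n.
Proof. by apply: (@complexI R); rewrite rmorphXn /= !cnormE normrX. Qed.

Lemma cnorm_eq0 z : cnorm z = 0 -> z = 0.
Proof. by move=> h; apply/eqP; rewrite -normr_eq0 -cnormE h. Qed.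

Lemma cnorm_distC z w : cnorm (z - w) = cnorm (w - z).
Proof. by rewrite -cnormN opprB. Qed.

Lemma cnorm_le_eq0 z : (forall e : R, 0 < e -> cnorm z <= e) -> z = 0.
Proof.
move=> h; apply: cnorm_eq0; apply/eqP; rewrite eq_le cnorm_ge0 andbT.
by apply/ler_addgt0Pl => e e0; rewrite addr0 h.
Qed.

Lemma cnorm_sum (I : Type) (r : seq I) (P : pred I) (F : I -> R[i]) :
  cnorm (\sum_(i <- r | P i) F i) <= \sum_(i <- r | P i) cnorm (F i).
Proof.
elim/big_ind2 : _ => //; first by rewrite cnorm0.
by move=> x y z w h1 h2; apply: le_trans (cnormD _ _) (lerD _ _).
Qed.

Lemma ler_norm_Re z : `|complex.Re z| <= cnorm z.
Proof. by rewrite -sqrtr_sqr ler_wsqrtr// lerDl sqr_ge0. Qed.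

Lemma ler_norm_Im z : `|complex.Im z| <= cnorm z.
Proof. by rewrite -sqrtr_sqr ler_wsqrtr// lerDr sqr_ge0. Qed.

Lemma cnorm_le_ReIm z : cnorm z <= `|complex.Re z| + `|complex.Im z|.
Proof.
rewrite -[leRHS]ger0_norm ?addr_ge0// -sqrtr_sqr ler_wsqrtr//.
rewrite sqrrD !real_normK ?num_real// lerD2r lerDl mulrn_wge0//.
Qed.

Lemma cnorm_conj z : cnorm (conjc z) = cnorm z.
Proof. by case: z => a b; rewrite /cnorm /= sqrrN. Qed.

Lemma cnorm_real (r : R) : cnorm (r%:C%C) = `|r|.
Proof. by rewrite /cnorm /= expr0n addr0 sqrtr_sqr. Qed.

Lemma ReD z w : complex.Re (z + w) = complex.Re z + complex.Re w.
Proof. by case: z; case: w. Qed.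

Lemma ImD z w : complex.Im (z + w) = complex.Im z + complex.Im w.
Proof. by case: z; case: w. Qed.

Lemma Re_sum (I : Type) (r : seq I) (P : pred I) (F : I -> R[i]) :
  complex.Re (\sum_(i <- r | P i) F i) = \sum_(i <- r | P i) complex.Re (F i).
Proof. exact: (big_morph _ ReD). Qed.

Lemma Im_sum (I : Type) (r : seq I) (P : pred I) (F : I -> R[i]) :
  complex.Im (\sum_(i <- r | P i) F i) = \sum_(i <- r | P i) complex.Im (F i).
Proof. exact: (big_morph _ ImD). Qed.

End ComplexNorm.

(** * Bounded families of reals indexed by the integers, and their tails *)

Section IntegerSums.
Variable R : realType.
Local Open Scope ring_scope.

(** The half-open window [[-N, N)], asymmetric in the same way as the index set of [zpartial]. *)
Definition zint (N : nat) : seq int := [seq i%:Z - N%:Z | i <- iota 0 N.*2].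

Lemma zint_uniq N : uniq (zint N).
Proof. by rewrite map_inj_uniq ?iota_uniq// => i j; lia. Qed.

Lemma mem_zint N k : (k \in zint N) = (- N%:Z <= k) && (k < N%:Z).
Proof.
apply/mapP/idP => [[j]|h]; first by rewrite mem_iota; lia.
by exists (absz (k + N%:Z)); rewrite ?mem_iota; lia.
Qed.

Lemma zint_cover (s : seq int) : exists N, {subset s <= zint N}.
Proof.
elim: s => [|k s [N h]]; first by exists 0%N.
exists (N + (absz k).+1)%N => j; rewrite inE => /orP[/eqP->|/h]; rewrite !mem_zint; lia.
Qed.

Lemma zint_mono N M : (N <= M)%N -> {subset zint N <= zint M}.
Proof. by move=> h k; rewrite !mem_zint; lia. Qed.

(** Passing from ordinals to lists makes subset and permutation arguments available; [V] is general
    so that real and complex families are both covered. *)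
Lemma zpartialE (V : nmodType) (u : int -> V) N :
  \sum_(i < N.*2) u (i%:Z - N%:Z) = \sum_(k <- zint N) u k.
Proof. by rewrite big_map -(big_mkord xpredT (fun j : nat => u (j%:Z - N%:Z))) /index_iota subn0. Qed.

Lemma big_subseqE (V : nmodType) (s0 s : seq int) (u : int -> V) :
  uniq s0 -> uniq s -> {subset s0 <= s} ->
  \sum_(k <- s) u k = \sum_(k <- s0) u k + \sum_(k <- s | k \notin s0) u k.
Proof.
move=> u0 us sub; rewrite (bigID (mem s0)) /=; congr (_ + _).
rewrite -big_filter; apply: perm_big; apply: uniq_perm => //.
  exact: filter_uniq.
by move=> k; rewrite mem_filter; case: (boolP (k \in s0)) => //= /sub.
Qed.

Lemma big_sub_le (s0 s : seq int) (A : int -> R) :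
  (forall k, 0 <= A k) -> uniq s0 -> uniq s -> {subset s0 <= s} ->
  \sum_(k <- s0) A k <= \sum_(k <- s) A k.
Proof.
by move=> A0 u0 us sub; rewrite (big_subseqE A u0 us sub) lerDl sumr_ge0.
Qed.

Definition zbnd (A : int -> R) (M : R) := forall N, zpartial A N <= M.

(** Every finite set lies in some window, so for nonnegative terms bounding the windows bounds all
    finite sums. *)
Lemma zbndP (A : int -> R) M : (forall k, 0 <= A k) ->
  zbnd A M <-> forall s, uniq s -> \sum_(k <- s) A k <= M.
Proof.
move=> A0; split=> [h s us|h N]; last by rewrite /zpartial zpartialE h// zint_uniq.
have [N sN] := zint_cover s; apply: le_trans (h N).
by rewrite /zpartial zpartialE big_sub_le// zint_uniq.
Qed.

Lemma zbnd_ge0 (A : int -> R) M : zbnd A M -> 0 <= M.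
Proof. by move=> /(_ 0%N); rewrite /zpartial big_ord0. Qed.

Lemma zbnd_le (A B : int -> R) M M' :
  (forall k, A k <= B k) -> zbnd B M -> M <= M' -> zbnd A M'.
Proof. by move=> AB h MM N; apply: le_trans MM; apply: le_trans (h N); apply: ler_sum. Qed.

Lemma zbndD (A B : int -> R) M M' :
  zbnd A M -> zbnd B M' -> zbnd (fun k => A k + B k) (M + M').
Proof. by move=> h h' N; rewrite /zpartial big_split; apply: lerD; [exact: h|exact: h']. Qed.

Lemma zbndZ (A : int -> R) M c :
  0 <= c -> zbnd A M -> zbnd (fun k => c * A k) (c * M).
Proof. by move=> c0 h N; rewrite /zpartial -mulr_sumr ler_wpM2l//; exact: h. Qed.

Lemma zbnd_fin (A : int -> R) (s0 : seq int) : (forall k, 0 <= A k) ->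
  uniq s0 -> (forall k, k \notin s0 -> A k = 0) -> zbnd A (\sum_(k <- s0) A k).
Proof.
move=> A0 us0 h; apply/zbndP => // r ur; pose t := undup (r ++ s0).
have ut : uniq t by exact: undup_uniq.
have rt : {subset r <= t} by move=> k kr; rewrite mem_undup mem_cat kr.
have st : {subset s0 <= t} by move=> k kr; rewrite mem_undup mem_cat kr orbT.
apply: le_trans (big_sub_le A0 ur ut rt) _.
by rewrite (big_subseqE A us0 ut st) [X in _ + X]big1 ?addr0.
Qed.

Lemma zbnd_term (A : int -> R) M k : (forall k, 0 <= A k) -> zbnd A M -> A k <= M.
Proof. by move=> A0 /(zbndP _ A0)/(_ [:: k] isT); rewrite big_seq1. Qed.

Lemma zbnd_inj (A : int -> R) M (h : int -> int) : (forall k, 0 <= A k) ->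
  injective h -> zbnd A M -> zbnd (A \o h) M.
Proof.
move=> A0 hi /(zbndP _ A0) b; apply/zbndP => [k|s us]; first exact: A0.
by rewrite -(big_map h xpredT A) b// map_inj_uniq.
Qed.

Lemma zpartial_homo (A : int -> R) : (forall k, 0 <= A k) ->
  {homo zpartial A : n m / (n <= m)%N >-> n <= m}.
Proof.
move=> A0 n m nm; rewrite /zpartial !zpartialE big_sub_le// ?zint_uniq//.
exact: zint_mono.
Qed.

Lemma zbnd_cvg (A : int -> R) M : (forall k, 0 <= A k) -> zbnd A M ->
  cvgn (zpartial A).
Proof.
move=> A0 h; apply: nondecreasing_is_cvgn; first exact: zpartial_homo.
by exists M => _ [N _ <-].
Qed.

Lemma zbnd_lim (A : int -> R) M : (forall k, 0 <= A k) -> zbnd A M ->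
  zbnd A (zsumR A).
Proof.
move=> A0 h N; apply: nondecreasing_cvgn_le; first exact: zpartial_homo.
exact: zbnd_cvg h.
Qed.

Definition ztail (V : nmodType) (s : seq int) (u : int -> V) : int -> V :=
  fun k => if k \in s then 0 else u k.

(** Choose a window whose sum is within [e] of the total. A finite set outside it, joined to the
    window, still sums to at most the total, so the outside part is at most [e]. *)
Lemma zbnd_tail (A : int -> R) M e : (forall k, 0 <= A k) -> zbnd A M ->
  0 < e -> exists N, zbnd (ztail (zint N) A) e.
Proof.
move=> A0 h e0.
have := zbnd_cvg A0 h; move=> /cvgrPdist_le /(_ e e0).
have hl := zbnd_lim A0 h; rewrite /zsumR in hl.
case=> N _ hN; exists N; apply/zbndP => [k|s us]; first by rewrite /ztail; case: ifP.
have {hN} := hN N (leqnn _); rewrite ger0_norm ?subr_ge0; last exact: hl.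
move=> hN; have /(zbndP _ A0)/(_ (zint N ++ [seq k <- s | k \notin zint N])) := hl.
rewrite cat_uniq zint_uniq filter_uniq// andbT.
have -> : has (mem (zint N)) [seq k <- s | k \notin zint N] = false.
  by apply/hasPn => k; rewrite mem_filter => /andP[].
move=> /(_ isT); rewrite big_cat big_filter /= => h2.
have -> : \sum_(k <- s) ztail (zint N) A k = \sum_(k <- s | k \notin zint N) A k.
  by rewrite [RHS]big_mkcond; apply: eq_bigr => k _; rewrite /ztail; case: ifP.
move: hN h2; rewrite {2}/zpartial zpartialE; lra.
Qed.

End IntegerSums.

(** * Unconditional convergence of complex series over the integers, and interchange of double
    sums *)

Section UnconditionalSums.
Variable R : realType.
Local Open Scope ring_scope.
Implicit Types (u v : int -> R[i]) (l c : R[i]).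

(** Convergence along the net of finite sets rather than along windows: this form is stable under
    every bijective reindexing, which moves windows but not the family of finite sets. *)
Definition zhas u l := forall e : R, 0 < e -> exists s0 : seq int,
  forall s, uniq s -> {subset s0 <= s} -> cnorm (l - \sum_(k <- s) u k) <= e.

Definition zsummable u (M : R) := zbnd (fun k => cnorm (u k)) M.

(** Windows are cofinal among finite sets. The auxiliary [cvgl] is stated for an abstract [p] so
    that it serves both the real and the imaginary part. *)
Lemma zhasE u l : zhas u l -> zsumC u = l.
Proof.
move=> h.
have cvgl (p : R[i] -> R) : (forall z w, p (z - w) = p z - p w) ->
    (forall z, `|p z| <= cnorm z) ->
    (forall s, p (\sum_(k <- s) u k) = \sum_(k <- s) p (u k)) ->
    zsumR (fun k => p (u k)) = p l.
  move=> pB pn ps; apply: cvg_lim => //; apply/cvgrPdist_le => e e0.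
  have [s0 hs] := h e e0; have [N hN] := zint_cover s0.
  exists N => // M /= NM; rewrite /zpartial (zpartialE (fun k => p (u k))) -ps -pB.
  apply: le_trans (pn _) (hs _ (zint_uniq M) _) => k /hN.
  exact: zint_mono.
rewrite /zsumC !cvgl; first by case: l {h cvgl}.
- by move=> [? ?] [? ?].
- exact: ler_norm_Im.
- by move=> s; rewrite Im_sum.
- by move=> [? ?] [? ?].
- exact: ler_norm_Re.
- by move=> s; rewrite Re_sum.
Qed.

(** Write [f = (f + A) - A]: both terms are nonnegative with bounded partial sums, so monotone
    convergence applies to each. *)
Lemma zpartial_cvg_dominated (f A : int -> R) M :
  (forall k, `|f k| <= A k) -> zbnd A M -> cvgn (zpartial f).
Proof.
move=> fA h; have A0 k : 0 <= A k by apply: le_trans (fA k).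
have -> : zpartial f = (fun N => zpartial (fun k => f k + A k) N - zpartial A N).
  by apply/funext => N; rewrite /zpartial big_split /= addrK.
apply: is_cvgB; last exact: zbnd_cvg h.
apply: (@zbnd_cvg _ _ (M + M)) => [k|].
  by have := fA k; rewrite ler_norml => /andP[]; lra.
apply: zbndD => //; apply: zbnd_le h (lexx _) => k.
by apply: le_trans (fA k); exact: ler_norm.
Qed.

(** Compare the sum with a finite sum over [s] through a larger window [K] containing [s]: the
    window sum [P] is near the limit by convergence, and it differs from the sum over [s] only by
    terms of a small tail. *)
Lemma zsummable_has u M : zsummable u M -> zhas u (zsumC u).
Proof.
move=> h e e0; have e2 : 0 < e / 2 by rewrite divr_gt0.
(* The budget is a quarter of [e] for each of the real and imaginary parts, and half for the
   tail. *)
have e4 : 0 < e / 2 / 2 by rewrite divr_gt0.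
have [N hN] := zbnd_tail (fun k => cnorm_ge0 (u k)) h e2.
exists (zint N) => s us sN.
have /cvgrPdist_le/(_ _ e4)[K1 _ hK1] :=
  zpartial_cvg_dominated (fun k => ler_norm_Re (u k)) h.
have /cvgrPdist_le/(_ _ e4)[K2 _ hK2] :=
  zpartial_cvg_dominated (fun k => ler_norm_Im (u k)) h.
have [K3 hK3] := zint_cover s.
pose K := (K1 + K2 + K3)%N.
have {}hK1 := hK1 K (ltac:(rewrite /K /=; lia)).
have {}hK2 := hK2 K (ltac:(rewrite /K /=; lia)).
have sK : {subset s <= zint K}.
  by move=> k /hK3; apply: zint_mono; rewrite /K; lia.
pose P := \sum_(k <- zint K) u k.
have h1 : cnorm (zsumC u - P) <= e / 2.
  apply: le_trans (cnorm_le_ReIm _) _.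
  have -> : complex.Re (zsumC u - P) =
    limn (zpartial (fun k => complex.Re (u k))) -
    zpartial (fun k => complex.Re (u k)) K.
    by rewrite /zpartial (zpartialE (fun k => complex.Re (u k))) -Re_sum /zsumC -/P; case: P.
  have -> : complex.Im (zsumC u - P) =
    limn (zpartial (fun k => complex.Im (u k))) -
    zpartial (fun k => complex.Im (u k)) K.
    by rewrite /zpartial (zpartialE (fun k => complex.Im (u k))) -Im_sum /zsumC -/P; case: P.
  by move: hK1 hK2; lra.
have h2 : cnorm (P - \sum_(k <- s) u k) <= e / 2.
  rewrite /P (big_subseqE u us (zint_uniq K) sK) addrC addKr.
  apply: le_trans (cnorm_sum _ _ _) _.
  have /zbndP-/(_ _ [seq k <- zint K | k \notin s]) := hN.
  rewrite filter_uniq ?zint_uniq// big_filter => h3.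
  rewrite big_mkcond; rewrite big_mkcond in h3.
  apply: le_trans (h3 _ isT); last by move=> k; rewrite /ztail; case: ifP => // _; apply: cnorm_ge0.
  apply: ler_sum => k _; case: ifPn => // ks.
  by rewrite /ztail ifN//; apply: contra ks; apply: sN.
have -> : zsumC u - \sum_(k <- s) u k = (zsumC u - P) + (P - \sum_(k <- s) u k).
  by rewrite addrA subrK.
by apply: le_trans (cnormD _ _) _; move: h1 h2; lra.
Qed.

Lemma zhas_le u l M : zhas u l -> zsummable u M -> cnorm l <= M.
Proof.
move=> h b; apply/ler_addgt0Pl => e e0; have [s0 hs] := h e e0.
(* The set provided by [zhas] may contain repetitions. *)
pose s := undup s0; have us : uniq s by exact: undup_uniq.
have {}hs : cnorm (l - \sum_(k <- s) u k) <= e.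
  by apply: hs => // k; rewrite mem_undup.
rewrite -[l](subrK (\sum_(k <- s) u k)); apply: le_trans (cnormD _ _) (lerD hs _).
apply: le_trans (cnorm_sum _ _ _) _.
by move/zbndP : b; apply => // k; apply: cnorm_ge0.
Qed.

Lemma zhas_fin u (s0 : seq int) : uniq s0 -> (forall k, k \notin s0 -> u k = 0) ->
  zhas u (\sum_(k <- s0) u k).
Proof.
move=> us0 h e e0; exists s0 => s us sub.
by rewrite (big_subseqE u us0 us sub) [X in _ - (_ + X)]big1 ?addr0 ?subrr ?cnorm0 ?ltW.
Qed.

Lemma zhas1 u k0 : (forall k, k != k0 -> u k = 0) -> zhas u (u k0).
Proof.
move=> h; rewrite -[u k0](big_seq1 +%R k0 u); apply: zhas_fin => // k.
by rewrite inE; exact: h.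
Qed.

Lemma zhas0 : zhas (fun _ => 0) 0.
Proof. exact: (@zhas1 (fun _ => 0) 0). Qed.

Lemma zhasD u v l l' : zhas u l -> zhas v l' -> zhas (fun k => u k + v k) (l + l').
Proof.
move=> h h' e e0; have e2 : 0 < e / 2 by rewrite divr_gt0.
have [s1 h1] := h _ e2; have [s2 h2] := h' _ e2; exists (s1 ++ s2) => s us sub.
rewrite big_split /= opprD addrACA; apply: le_trans (cnormD _ _) _.
rewrite [leRHS](splitr e) lerD//; [apply: h1|apply: h2] => // k ks; apply: sub.
  by rewrite mem_cat ks.
by rewrite mem_cat ks orbT.
Qed.

Lemma zhasZ u l c : zhas u l -> zhas (fun k => c * u k) (c * l).
Proof.
move=> h e e0; have c1 : 0 < cnorm c + 1 by rewrite ltr_wpDl ?cnorm_ge0.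
have e2 : 0 < e / (cnorm c + 1) by rewrite divr_gt0.
have [s0 hs] := h _ e2; exists s0 => s us sub.
rewrite -mulr_sumr -mulrBr cnormM.
apply: le_trans (ler_wpM2l (cnorm_ge0 c) (hs s us sub)) _.
by rewrite mulrCA ger_pMr// ler_pdivrMr// mul1r lerDl.
Qed.

Lemma zhas_sum (I : Type) (r : seq I) (f : I -> int -> R[i]) (g : I -> R[i]) :
  (forall i, zhas (f i) (g i)) ->
  zhas (fun k => \sum_(i <- r) f i k) (\sum_(i <- r) g i).
Proof.
move=> h; elim: r => [|i r IH].
  rewrite big_nil (_ : (fun _ => _) = fun _ => 0); first exact: zhas0.
  by apply/funext => k; rewrite big_nil.
rewrite big_cons (_ : (fun _ => _) = fun k => f i k + \sum_(i <- r) f i k).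
  exact: zhasD.
by apply/funext => k; rewrite big_cons.
Qed.

Lemma zhas_bij u l (h g : int -> int) : cancel h g -> cancel g h ->
  zhas u l -> zhas (u \o h) l.
Proof.
move=> hg gh H e e0; have [s0 hs] := H e e0; exists (map g s0) => s us sub.
rewrite -(big_map h xpredT u); apply: hs.
  by rewrite map_inj_uniq//; exact: can_inj hg.
by move=> k ks; rewrite -[k]gh map_f// sub// map_f.
Qed.

Lemma zhas_conj u l : zhas u l -> zhas (fun k => conjc (u k)) (conjc l).
Proof.
move=> H e e0; have [s0 hs] := H e e0; exists s0 => s us sub.
by rewrite -rmorph_sum -rmorphB cnorm_conj hs.
Qed.

Lemma zhas_tail u l s : uniq s -> zhas u l ->
  zhas (ztail s u) (l - \sum_(k <- s) u k).
Proof.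
move=> us hu.
have h1 : zhas (fun k => if k \in s then u k else 0) (\sum_(k <- s) u k).
  rewrite [X in zhas _ X](_ : _ = \sum_(k <- s) if k \in s then u k else 0).
    by apply: zhas_fin => // k /negbTE ->.
  by apply: eq_big_seq => k ->.
rewrite -mulN1r.
rewrite (_ : ztail _ _ = fun k => u k + -1 * if k \in s then u k else 0).
  exact: zhasD hu (zhasZ _ h1).
by apply/funext => k; rewrite /ztail; case: ifP => _; rewrite mulN1r ?subrr ?subr0.
Qed.

(* Phases [c n] with [c n * l n = cnorm (l n)] turn the sum of the moduli of the
   column sums into the modulus of a single series. *)
Lemma zsummable_col (d : int -> int -> R[i]) (l : int -> R[i]) (B : int -> R) M :
  (forall k, zsummable (d k) (B k)) -> zbnd B M ->
  (forall n, zhas (fun k => d k n) (l n)) -> zsummable l M.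
Proof.
move=> hd hB hl; apply/zbndP => [k|s us]; first exact: cnorm_ge0.
pose c n : R[i] := if l n == 0 then 0 else (cnorm (l n))%:C%C / l n.
have cl n : c n * l n = (cnorm (l n))%:C%C.
  rewrite /c; case: eqVneq => [->|l0]; first by rewrite cnorm0 mulr0.
  by rewrite divfK.
have c1 n : cnorm (c n) <= 1.
  rewrite /c; case: eqVneq => [_|l0]; first by rewrite cnorm0.
  rewrite cnormM cnorm_real cnormV ger0_norm ?cnorm_ge0// divff//.
  by apply: contra l0 => /eqP/cnorm_eq0 ->.
have H := zhas_sum s (fun n => zhasZ (c n) (hl n)).
have : cnorm (\sum_(n <- s) c n * l n) <= M.
  apply: zhas_le H _; apply: zbnd_le hB (lexx _) => k.
  apply: le_trans (cnorm_sum _ _ _) _.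
  apply: (@le_trans _ _ (\sum_(n <- s) cnorm (d k n))).
    by apply: ler_sum => n _; rewrite cnormM ler_piMl// cnorm_ge0.
  by move/zbndP : (hd k); apply => // n; apply: cnorm_ge0.
under eq_bigr do rewrite cl.
by rewrite -rmorph_sum /= cnorm_real ger0_norm ?sumr_ge0// => n _; apply: cnorm_ge0.
Qed.

(** Split off a finite set [s] of rows carrying all but [e / 2] of the mass. For these rows the
    interchange is finite additivity, so they cancel in the difference. The remainder is at most
    [e / 2] on each side, the column side by [zsummable_col]. *)
Lemma zhas_fubini (d : int -> int -> R[i]) (l r : int -> R[i]) (B : int -> R) M :
  (forall k, zsummable (d k) (B k)) -> zbnd B M ->
  (forall n, zhas (fun k => d k n) (l n)) ->
  (forall k, zhas (d k) (r k)) ->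
  zsumC l = zsumC r.
Proof.
move=> hd hB hl hr; have B0 k : 0 <= B k by exact: zbnd_ge0 (hd k).
have sl := zsummable_col hd hB hl.
have sr : zsummable r M.
  by apply: zbnd_le hB (lexx _) => k; exact: zhas_le (hr k) (hd k).
apply/eqP; rewrite -subr_eq0; apply/eqP; apply: cnorm_le_eq0 => e e0.
have e2 : 0 < e / 2 by rewrite divr_gt0.
have [N hN] := zbnd_tail B0 hB e2; set s := zint N in hN.
have us : uniq s by exact: zint_uniq.
pose dt k n := if k \in s then 0 else d k n.
pose lt n := l n - \sum_(k <- s) d k n.
have hlt n : zhas (fun k => dt k n) (lt n) by exact: zhas_tail.
have dtB k : zsummable (dt k) (ztail s B k).
  rewrite /zsummable /dt /ztail; case: ifP => _; last exact: hd.
  by rewrite cnorm0 => K; rewrite /zpartial big1.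
have slt := zsummable_col dtB hN hlt.
have -> : zsumC l - zsumC r = zsumC lt - zsumC (ztail s r).
  have h1 := zsummable_has slt.
  have h2 : zhas (fun n => \sum_(k <- s) d k n) (\sum_(k <- s) r k).
    exact: zhas_sum.
  have := zhasE (zhasD h1 h2).
  rewrite (_ : (fun k => _) = l); last by apply/funext => n; rewrite subrK.
  by move=> ->; rewrite (zhasE (zhas_tail us (zsummable_has sr))) opprB addrA.
apply: le_trans (cnormD _ _) _; rewrite cnormN [leRHS](splitr e) lerD//.
  exact: zhas_le (zsummable_has slt) slt.
have st : zsummable (ztail s r) (e / 2).
  apply: zbnd_le hN (lexx _) => k; rewrite /ztail; case: ifP => _.
    by rewrite cnorm0.
  exact: zhas_le (hr k) (hd k).
exact: zhas_le (zsummable_has st) st.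
Qed.

End UnconditionalSums.

(** * Roots of unity and the bound of Fourier coefficients by the sup norm *)

Section FourierCoefficients.
Variable R : realType.
Local Open Scope ring_scope.
Implicit Types (u : int -> R[i]) (z : R[i]).

(** ['X^n - 1] splits over the algebraically closed field and is separable in characteristic 0, so
    it has [n] distinct roots; such a full set of roots of unity contains a primitive one. *)
Lemma complex_prim_root_exists n : (0 < n)%N ->
  exists z : R[i], n.-primitive_root z.
Proof.
pose p : {poly R[i]} := 'X^n - 1; have [r Dp] := closed_field_poly_normal p.
move=> n_gt0; rewrite (monicP _) ?monicXnsubC // scale1r in Dp.
have rn1 : all n.-unity_root r by apply/allP=> z; rewrite -root_prod_XsubC -Dp.
have sz_r : (n < (size r).+1)%N.
  by rewrite -(size_prod_XsubC r id) -Dp size_XnsubC.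
have [|z] := hasP (has_prim_root n_gt0 rn1 _ sz_r); last by exists z.
by rewrite -separable_prod_XsubC -Dp separable_Xn_sub_1 // pnatr_eq0 -lt0n.
Qed.

Lemma cnorm1_neq0 z : cnorm z = 1 -> z != 0.
Proof. by move=> h; apply/eqP => z0; move: h; rewrite z0 cnorm0 => /esym/eqP; rewrite oner_eq0. Qed.

Lemma cnormXz z (k : int) : cnorm z = 1 -> cnorm (z ^ k) = 1.
Proof.
move=> h; case: k => n; first by rewrite -exprnP cnormX h expr1n.
by rewrite NegzE -exprnN cnormV cnormX h expr1n invr1.
Qed.

Lemma prim_root_cnorm n z : n.-primitive_root z -> cnorm z = 1.
Proof.
move=> pz; have n0 := prim_order_gt0 pz; apply/eqP.
by rewrite -(@pexpr_eq1 _ _ n) ?cnorm_ge0// -cnormX prim_expr_order// cnorm1.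
Qed.

(** A geometric sum of ratio [z ^ d], which differs from 1 while its [n]-th power equals 1. *)
Lemma prim_root_sum_expz n z (d : int) : n.-primitive_root z ->
  (0 < absz d)%N -> (absz d < n)%N -> \sum_(j < n) (z ^+ j) ^ d = 0.
Proof.
move=> pz d0 dn; have zn0 := cnorm1_neq0 (prim_root_cnorm pz).
have zd1 : z ^ d != 1.
  have h (e : nat) : (0 < e)%N -> (e < n)%N -> z ^+ e != 1.
    by move=> e0 en; rewrite -(prim_order_dvd pz) gtnNdvd.
  case: d d0 dn => e; rewrite ?NegzE -?exprnN -?exprnP ?abszN /=; first exact: h.
  by move=> e0 en; rewrite invr_eq1 h.
apply/eqP; rewrite (eq_bigr (fun j : 'I_n => (z ^ d) ^+ j)); last first.
  by move=> j _; rewrite !exprnP !exprz_exp mulrC.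
have := subrX1 (z ^ d) n; rewrite exprnP exprz_exp mulrC -exprz_exp -exprnP.
rewrite (prim_expr_order pz) exp1rz subrr => /esym/eqP.
by rewrite mulf_eq0 subr_eq0 (negbTE zd1).
Qed.

(** Discrete Fourier inversion: averaging [w ^ (- m)] times the series over the [N]-th roots of
    unity [w] leaves [u m] plus aliased terms. These lie in a tail of size at most [e], while the
    average itself is at most [C]. *)
Lemma fourier_coef_le u M C m : zsummable u M ->
  (forall z, cnorm z = 1 -> cnorm (zsumC (fun k => u k * z ^ k)) <= C) ->
  cnorm (u m) <= C.
Proof.
move=> su hC; apply/ler_addgt0Pl => e e0.
have [K hK] := zbnd_tail (fun k => cnorm_ge0 (u k)) su e0.
(* For [k] in the window of [K], [absz (k - m)] is at most [K + absz m], hence below [N], so no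
   aliasing occurs inside the window. *)
pose N := (K + absz m).+1.
have [z pz] := @complex_prim_root_exists N isT.
have z1 j : cnorm (z ^+ j) = 1 by rewrite cnormX (prim_root_cnorm pz) expr1n.
have zn0 j : z ^+ j != 0 by exact: cnorm1_neq0.
have N0 : (N%:R : R[i]) != 0 by rewrite pnatr_eq0.
have nN : cnorm (N%:R : R[i])^-1 = N%:R^-1.
  by rewrite cnormV -(rmorph_nat (real_complex R)) cnorm_real ger0_norm.
(* The averaged character: 1 at 0, zero for other [d] with [absz d < N], and of modulus at most 1
   everywhere. *)
pose g (d : int) := \sum_(j < N) N%:R^-1 * (z ^+ j) ^ d.
have g1 d : cnorm (g d) <= 1.
  apply: le_trans (cnorm_sum _ _ _) _.
  under eq_bigr do rewrite cnormM cnormXz// mulr1 nN.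
  by rewrite sumr_const card_ord -[_ *+ N]mulr_natr mulVf// pnatr_eq0.
have g0 : g 0 = 1.
  rewrite /g; under eq_bigr do rewrite expr0z mulr1.
  by rewrite sumr_const card_ord -[_ *+ N]mulr_natr mulVf.
have gd (d : int) : (0 < absz d)%N -> (absz d < N)%N -> g d = 0.
  by move=> d0 dN; rewrite /g -mulr_sumr (prim_root_sum_expz pz)// mulr0.
have su' (w : R[i]) : cnorm w = 1 -> zsummable (fun k => u k * w ^ k) M.
  by move=> hw; apply: zbnd_le su (lexx _) => k; rewrite cnormM cnormXz// mulr1.
pose L := \sum_(j < N) (N%:R^-1 * (z ^+ j) ^ (- m)) *
   zsumC (fun k => u k * (z ^+ j) ^ k).
have hL : zhas (fun k => u k * g (k - m)) L.
  have := zhas_sum (index_enum 'I_N) (fun j : 'I_N =>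
    zhasZ (N%:R^-1 * (z ^+ j) ^ (- m)) (zsummable_has (su' _ (z1 j)))).
  rewrite (_ : (fun k => _) = (fun k => u k * g (k - m))) //.
  apply/funext => k; rewrite /g mulr_sumr; apply: eq_bigr => j _.
  by rewrite addrC expfzDr//; ring.
have nL : cnorm L <= C.
  apply: le_trans (cnorm_sum _ _ _) _.
  apply: (@le_trans _ _ (\sum_(j < N) N%:R^-1 * C)).
    apply: ler_sum => j _; rewrite !cnormM nN cnormXz// mulr1.
    by rewrite ler_wpM2l// ?invr_ge0// hC.
  by rewrite sumr_const card_ord -[_ *+ N]mulr_natl mulrA divff ?mul1r// pnatr_eq0.
have hm : zhas (fun k => if k == m then u m else 0) (u m).
  have := @zhas1 _ (fun k => if k == m then u m else 0) m; rewrite eqxx; apply.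
  by move=> k /negbTE ->.
have hd := zhasD hL (zhasZ (-1) hm).
have : cnorm (L + -1 * u m) <= e.
  apply: (zhas_le hd); apply: zbnd_le hK (lexx _) => k.
  rewrite /ztail; case: (eqVneq k m) => [->|km].
    by rewrite subrr g0 mulr1 mulN1r subrr cnorm0; case: ifP => // _; apply: cnorm_ge0.
  rewrite mulr0 addr0; case: ifPn => kK; last first.
    by rewrite cnormM ler_piMr ?cnorm_ge0.
  rewrite gd ?mulr0 ?cnorm0//; first by move: km; lia.
  by move: kK; rewrite mem_zint /N; lia.
rewrite mulN1r cnorm_distC => h.
rewrite -[u m](subrK L); apply: le_trans (cnormD _ _) _; exact: lerD.
Qed.

End FourierCoefficients.

(** * Continuous complex functions and their sup norm *)

Section ContinuousFunctions.
Variables (R : realType) (X : topologicalType).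
Local Open Scope ring_scope.
Implicit Types (f g : X -> R[i]).

Lemma ccontinuous_cst (c : R[i]) : ccontinuous (fun _ : X => c).
Proof. by split; apply: cst_continuous. Qed.

Lemma ccontinuousD f g : ccontinuous f -> ccontinuous g ->
  ccontinuous (fun x => f x + g x).
Proof.
move=> [f1 f2] [g1 g2]; split => x.
  under [X in continuous_at _ X]eq_fun do rewrite ReD.
  by apply: continuousD; [exact: f1|exact: g1].
under [X in continuous_at _ X]eq_fun do rewrite ImD.
by apply: continuousD; [exact: f2|exact: g2].
Qed.

Lemma ReM (z w : R[i]) : complex.Re (z * w) =
  complex.Re z * complex.Re w - complex.Im z * complex.Im w.
Proof. by case: z; case: w. Qed.

Lemma ImM (z w : R[i]) : complex.Im (z * w) =
  complex.Re z * complex.Im w + complex.Im z * complex.Re w.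
Proof. by case: z; case: w. Qed.

Lemma ccontinuousM f g : ccontinuous f -> ccontinuous g ->
  ccontinuous (fun x => f x * g x).
Proof.
move=> [f1 f2] [g1 g2]; split => x.
  under [X in continuous_at _ X]eq_fun do rewrite ReM.
  by apply: cvgB; apply: cvgM; [exact: f1|exact: g1|exact: f2|exact: g2].
under [X in continuous_at _ X]eq_fun do rewrite ImM.
by apply: cvgD; apply: cvgM; [exact: f1|exact: g2|exact: f2|exact: g1].
Qed.

Lemma ccontinuous_sum (I : Type) (r : seq I) (F : I -> X -> R[i]) :
  (forall i, ccontinuous (F i)) -> ccontinuous (fun x => \sum_(i <- r) F i x).
Proof.
move=> h; elim: r => [|i r IH].
  under [X in ccontinuous X]eq_fun do rewrite big_nil.
  exact: ccontinuous_cst.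
under [X in ccontinuous X]eq_fun do rewrite big_cons.
exact: ccontinuousD.
Qed.

(** Uniform limits of continuous functions are continuous, by thirds of epsilon; [key] treats the
    two coordinates at once. *)
Lemma ccontinuous_unif f :
  (forall e : R, 0 < e -> exists2 g, ccontinuous g &
    forall x, cnorm (f x - g x) <= e) -> ccontinuous f.
Proof.
move=> h.
have key (p : R[i] -> R) : (forall z w, p (z - w) = p z - p w) ->
    (forall z, `|p z| <= cnorm z) ->
    (forall g, ccontinuous g -> continuous (fun x => p (g x))) ->
    continuous (fun x => p (f x)).
  move=> pB pn pc x; apply/cvgrPdist_le => e e0.
  have e3 : 0 < e / 3 by rewrite divr_gt0.
  have [g cg fg] := h _ e3.
  have /cvgrPdist_le/(_ _ e3) := pc g cg x.
  apply: filterS => y hy.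
  have h1 := le_trans (pn _) (fg x); have h2 := le_trans (pn _) (fg y).
  rewrite !pB in h1 h2.
  have -> : p (f x) - p (f y) =
    (p (f x) - p (g x)) + (p (g x) - p (g y)) - (p (f y) - p (g y)) by ring.
  apply: le_trans (ler_normB _ _) _.
  have := ler_normD (p (f x) - p (g x)) (p (g x) - p (g y)).
  by move: h1 h2 hy; rewrite /=; lra.
split; apply: key.
- by move=> [? ?] [? ?].
- exact: ler_norm_Re.
- by move=> g [].
- by move=> [? ?] [? ?].
- exact: ler_norm_Im.
- by move=> g [].
Qed.

Hypothesis cX : compact [set: X].
Hypothesis X0 : [set: X] !=set0.

Lemma compact_continuous_bounded (f : X -> R) : continuous f ->
  exists M, forall x, `|f x| <= M.
Proof.
move=> cf; have : compact (f @` [set: X]).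
  by apply: continuous_compact => //; apply: continuous_subspaceT.
move=> /(@compact_bounded _ R^o)[M [_ hM]].
by exists (M + 1) => x; apply: (hM (M + 1)); rewrite ?ltrDl//; exists x.
Qed.

Lemma cnorm_le_supnorm f x : ccontinuous f -> cnorm (f x) <= supnorm f.
Proof.
move=> [f1 f2]; apply: sup_upper_bound; last by exists x.
have [x0 _] := X0; split; first by exists (cnorm (f x0)); exists x0.
have [M1 h1] := compact_continuous_bounded f1.
have [M2 h2] := compact_continuous_bounded f2.
exists (M1 + M2) => _ [y _ <-]; apply: le_trans (cnorm_le_ReIm _) _.
exact: lerD.
Qed.

Lemma supnorm_le f M : (forall x, cnorm (f x) <= M) -> supnorm f <= M.
Proof.
move=> h; apply: ge_sup; last by move=> _ [y _ <-].
by have [x0 _] := X0; exists (cnorm (f x0)); exists x0.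
Qed.

Lemma supnorm_ge0 f : 0 <= supnorm f.
Proof.
rewrite /supnorm; set E := (X in sup X).
(* When the set of moduli has no supremum, [sup] takes the default value 0. *)
have [hE|/sup_out -> //] := pselect (has_sup E).
have [x0 _] := X0; apply: le_trans (cnorm_ge0 (f x0)) _.
by apply: sup_upper_bound => //; exists x0.
Qed.

End ContinuousFunctions.

(** * The action of the integers generated by a bijection *)

Section IntegerIterates.
Variables (X : topologicalType) (s si : X -> X).
Hypotheses (ssi : cancel s si) (sis : cancel si s).
Local Open Scope ring_scope.

(** [zit] iterates [s] or [si] according to the sign; this one-step law glues the two halves and
    drives the induction for the group law. *)
Lemma zitS (k : int) x : zit s si (k + 1) x = s (zit s si k x).
Proof.
case: k => n; first by rewrite -PoszD addn1.
case: n => [|n]; first by rewrite /= sis.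
by rewrite (_ : Negz n.+1 + 1 = Negz n) /= ?sis//; lia.
Qed.

Lemma zitP (k : int) x : zit s si (k - 1) x = si (zit s si k x).
Proof. by rewrite -[k in RHS](subrK 1) zitS ssi. Qed.

Lemma zitD (j k : int) x : zit s si (j + k) x = zit s si j (zit s si k x).
Proof.
elim: j => [|n IH|n IH]; first by rewrite add0r.
  by rewrite -addn1 PoszD addrAC !zitS IH.
by rewrite -addn1 PoszD opprD addrAC !zitP IH.
Qed.

Lemma zit_fixN (k : int) x : zit s si k x = x -> zit s si (- k) x = x.
Proof. by move=> h; rewrite -{1}h -zitD addNr. Qed.

End IntegerIterates.

(** * The commutant as elements supported on periodic points, and its characters *)

Section Commutant.
Variables (R : realType) (X : topologicalType) (s si : X -> X).
Hypotheses (cX : compact [set: X]) (hX : hausdorff_space X).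
Hypotheses (X0 : [set: X] !=set0) (ssi : cancel s si) (sis : cancel si s).
Local Open Scope ring_scope.
Implicit Types (a b : elt R X).

(** The exponent is [- n] because the twist [alphak n] evaluates at that iterate; for a bijection
    the fixed points of both iterates agree. *)
Definition zit_supported a :=
  forall n x, a n x != 0 -> zit s si (- n) x = x.

Definition comm_bounded a (M : R) :=
  [/\ forall k, ccontinuous (a k), zbnd (fun k => supnorm (a k)) M
    & zit_supported a].

Definition gelfand a x z : R[i] := zsumC (fun n => a n x * z ^ n).

Lemma separating_function (x y : X) : x <> y ->
  exists f : X -> R[i], [/\ ccontinuous f, f x = 0 & f y = 1].
Proof.
move=> xy; have T1 := hausdorff_accessible hX.
have sep : uniform_separator [set x] [set y].
  apply: (normal_uniform_separator (compact_normal hX cX)).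
  - exact: accessible_closed_set1.
  - exact: accessible_closed_set1.
  - by rewrite -subset0 => z [/= -> /xy].
exists (fun t => (Urysohn [set x] [set y] t : R)%:C%C); split.
- split; first exact: Urysohn_continuous.
  exact: cst_continuous.
- by rewrite [Urysohn _ _ _](Urysohn_sub0 sep) //=; exists x.
- by rewrite [Urysohn _ _ _](Urysohn_sub1 sep) //=; exists y.
Qed.

Lemma l1mul_embr a f n x :
  l1mul s si a (l1emb f) n x = a n x * f (zit s si (- n) x).
Proof.
rewrite /l1mul /alphak /l1emb; set u := fun k => _.
rewrite (zhasE (@zhas1 _ u n _)); first by rewrite /u subrr eqxx.
by move=> k kn; rewrite /u subr_eq0 eq_sym (negbTE kn) mulr0.
Qed.

Lemma l1mul_embl a f n x : l1mul s si (l1emb f) a n x = f x * a n x.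
Proof.
rewrite /l1mul /alphak /l1emb; set u := fun k => _.
rewrite (zhasE (@zhas1 _ u 0 _)); first by rewrite /u eqxx subr0.
by move=> k kn; rewrite /u (negbTE kn) mul0r.
Qed.

(** At [(n, x)] the two products are [a n x * f y] and [f x * a n x], where [y] is the iterate of
    [x] under [- n]. If [y] is not [x], a function with value 0 at [y] and 1 at [x] forces
    [a n x = 0]. *)
Lemma commutantP a : commutant s si a <-> exists M, comm_bounded a M.
Proof.
split=> [[[ca [M aM]] h]|[M [ca aM fa]]].
  exists M; split => // n x ax; apply: contrapT => xn.
  have [f [cf fx fy]] := separating_function xn.
  have := congr1 (fun e => e n x) (h f cf).
  rewrite l1mul_embr l1mul_embl fx fy mulr0 => /esym ax0.
  by move: ax; rewrite -[a n x]mul1r ax0 eqxx.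
split; first by split => //; exists M.
move=> f cf; apply/funext => n; apply/funext => x.
rewrite l1mul_embr l1mul_embl mulrC.
by have [->|/fa ->] := eqVneq (a n x) 0; rewrite ?mulr0.
Qed.

Section Bounds.
Variables (a : elt R X) (M : R).
Hypothesis aM : comm_bounded a M.

Lemma cnorm_le_coef k x : cnorm (a k x) <= supnorm (a k).
Proof. by case: aM => ca _ _; apply: cnorm_le_supnorm. Qed.

Lemma comm_bounded_summable x z : cnorm z = 1 ->
  zsummable (fun n => a n x * z ^ n) M.
Proof.
move=> z1; case: aM => _ h _; apply: zbnd_le h (lexx _) => k.
by rewrite cnormM cnormXz// mulr1 cnorm_le_coef.
Qed.

Lemma comm_bounded_has x z : cnorm z = 1 ->
  zhas (fun n => a n x * z ^ n) (gelfand a x z).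
Proof. by move=> z1; exact: zsummable_has (comm_bounded_summable x z1). Qed.

Lemma gelfand_le x z : cnorm z = 1 -> cnorm (gelfand a x z) <= M.
Proof.
by move=> z1; exact: zhas_le (comm_bounded_has x z1) (comm_bounded_summable x z1).
Qed.

Lemma coef_le_gelfand C x n : (forall z, cnorm z = 1 -> cnorm (gelfand a x z) <= C) ->
  cnorm (a n x) <= C.
Proof.
apply: fourier_coef_le; have := @comm_bounded_summable x 1 (cnorm1 R).
by under eq_fun do rewrite exp1rz mulr1.
Qed.

Lemma comm_bounded_ge0 : 0 <= M.
Proof. by case: aM => _ /zbnd_ge0. Qed.

End Bounds.

(** Completeness in concrete form: an absolutely convergent series of elements has its sum in the
    commutant, with the expected norm bound and transform. Both products and Neumann series are
    obtained from it. *)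
Lemma comm_bounded_series (d : int -> elt R X) (B : int -> R) M :
  (forall k, comm_bounded (d k) (B k)) -> zbnd B M ->
  let e : elt R X := fun n x => zsumC (fun k => d k n x) in
  comm_bounded e M /\ forall x z, cnorm z = 1 ->
    gelfand e x z = zsumC (fun k => gelfand (d k) x z).
Proof.
move=> hd hB e.
have sB k n : supnorm (d k n) <= B k.
  by case: (hd k) => _ h _; apply: (zbnd_term n _ h) => j; exact: supnorm_ge0.
have su n x : zsummable (fun k => d k n x) M.
  apply: zbnd_le hB (lexx _) => k.
  by apply: le_trans (sB k n); exact: cnorm_le_coef (hd k) _ _.
have hu n x : zhas (fun k => d k n x) (e n x) := zsummable_has (su n x).
have sS n : zbnd (fun k => supnorm (d k n)) M.
  by apply: zbnd_le hB (lexx _) => k; exact: sB.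
have S0 n k : 0 <= supnorm (d k n) by exact: supnorm_ge0.
split; first split.
- move=> n; apply: ccontinuous_unif => r r0.
  have [N hN] := zbnd_tail (S0 n) (sS n) r0.
  exists (fun x => \sum_(k <- zint N) d k n x).
    by apply: ccontinuous_sum => k; case: (hd k).
  move=> x; apply: zhas_le (zhas_tail (zint_uniq N) (hu n x)) _.
  apply: zbnd_le hN (lexx _) => k; rewrite /ztail; case: ifP => _.
    by rewrite cnorm0.
  exact: cnorm_le_coef (hd k) _ _.
(* The sup norms are regarded as complex numbers so that [zsummable_col] bounds the sum over [n] of
   the column sums, each of which dominates [supnorm (e n)]. *)
- pose D k n : R[i] := (supnorm (d k n))%:C%C.
  have nD k n : cnorm (D k n) = supnorm (d k n) by rewrite cnorm_real ger0_norm.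
  have hD k : zsummable (D k) (B k).
    by case: (hd k) => _ h _; apply: zbnd_le h (lexx _) => n; rewrite nD.
  have hl n : zhas (fun k => D k n) (zsumC (fun k => D k n)).
    by apply: (@zsummable_has _ _ M); apply: zbnd_le (sS n) (lexx _) => k; rewrite nD.
  apply: zbnd_le (zsummable_col hD hB hl) (lexx _) => n.
  apply: supnorm_le => // x.
  apply: (@le_trans _ _ (zsumR (fun k => supnorm (d k n)))).
    apply: zhas_le (hu n x) _; apply: zbnd_le (zbnd_lim (S0 n) (sS n)) (lexx _) => k.
    exact: cnorm_le_coef (hd k) _ _.
  apply: le_trans (ler_norm_Re _); rewrite ler_norm//.
- move=> n x /eqP ex; apply: contrapT => xn; apply: ex.
  rewrite -(zhasE (@zhas0 R)); congr zsumC; apply/funext => k; apply/eqP; apply: contrapT => /negP dk; apply: xn.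
  by case: (hd k) => _ _; apply.
move=> x z z1.
apply: (zhas_fubini (d := fun k n => d k n x * z ^ n) (B := B) (M := M)) => //.
- by move=> k; exact: comm_bounded_summable (hd k) _ _ z1.
- move=> n; under [X in zhas X _]eq_fun do rewrite mulrC.
  by rewrite mulrC; exact: zhasZ.
- by move=> k; exact: comm_bounded_has (hd k) _ _ z1.
Qed.

(** The product is the series over [k] of the elements [d k], whose transform is [a k x * z ^ k]
    times that of [b] after a shift of index; summing over [k] factors the transform. *)
Lemma comm_bounded_mul a b M M' : comm_bounded a M -> comm_bounded b M' ->
  comm_bounded (l1mul s si a b) (M * M') /\ forall x z, cnorm z = 1 ->
    gelfand (l1mul s si a b) x z = gelfand a x z * gelfand b x z.
Proof.
move=> ha hb; have [ca sa fa] := ha; have [cb sb fb] := hb.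
pose d k : elt R X := fun n x => a k x * b (n - k) x.
have hd k : comm_bounded (d k) (supnorm (a k) * M').
  split.
  - by move=> n; exact: ccontinuousM.
  - have shift_inj : injective (fun n : int => n - k) by exact: addIr.
    have := zbndZ (supnorm_ge0 X0 (a k)) (zbnd_inj (fun n => supnorm_ge0 X0 (b n)) shift_inj sb).
    move=> h; apply: zbnd_le h (lexx _) => n; apply: supnorm_le => // x.
    rewrite cnormM; apply: ler_pM; rewrite ?cnorm_ge0//.
      exact: cnorm_le_coef ha _ _.
    exact: cnorm_le_coef hb _ _.
  - move=> n x; rewrite mulf_eq0 negb_or => /andP[/fa fk /fb fnk].
    by rewrite (_ : - n = - k + - (n - k)); [rewrite zitD// fnk|lia].
have hB : zbnd (fun k => supnorm (a k) * M') (M * M').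
  rewrite mulrC; under eq_fun do rewrite mulrC.
  exact: zbndZ (comm_bounded_ge0 hb) sa.
(* Wherever [a k x] is nonzero, [x] is fixed by the iterate in [alphak k], so the twist
   disappears. *)
have mulE : l1mul s si a b = fun n x => zsumC (fun k => d k n x).
  apply/funext => n; apply/funext => x; congr zsumC; apply/funext => k.
  by rewrite /d /alphak; have [->|/fa ->] := eqVneq (a k x) 0; rewrite ?mul0r.
have [h1 h2] := comm_bounded_series hd hB.
rewrite mulE; split => // x z z1; rewrite h2//.
have z0 := cnorm1_neq0 z1.
rewrite [RHS]mulrC -(zhasE (zhasZ (gelfand b x z) (comm_bounded_has ha x z1))).
congr zsumC; apply/funext => k; apply: zhasE.
have h := zhas_bij (subrK k) (addrK k) (comm_bounded_has hb x z1).
have hk := zhasZ (a k x * z ^ k) h; rewrite mulrC.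
rewrite [X in zhas X _](_ : _ = fun n => a k x * z ^ k *
  ((fun n => b n x * z ^ n) \o (fun n => n - k)) n) //.
apply/funext => n /=.
by rewrite /d -{2}[n](subrK k) addrC expfzDr//; ring.
Qed.

(** The coefficient bound applied to the difference, with sup norm 0. *)
Lemma gelfand_inj a b M M' : comm_bounded a M -> comm_bounded b M' ->
  (forall x z, cnorm z = 1 -> gelfand a x z = gelfand b x z) -> a = b.
Proof.
move=> ha hb hab; apply/funext => n; apply/funext => x.
apply/eqP; rewrite -subr_eq0; apply/eqP/cnorm_eq0/eqP; rewrite eq_le cnorm_ge0 andbT.
have sab z : cnorm z = 1 -> zsummable (fun k => (a k x - b k x) * z ^ k) (M + M').
  move=> z1; apply: zbnd_le (zbndD (comm_bounded_summable ha x z1)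
    (comm_bounded_summable hb x z1)) (lexx _) => k.
  by rewrite mulrBl -[cnorm (b k x * _)]cnormN cnormD.
apply: (@fourier_coef_le _ (fun k => a k x - b k x) (M + M') 0 n).
  have := sab 1 (cnorm1 R); by under eq_fun do rewrite exp1rz mulr1.
move=> z z1; have := zhasD (comm_bounded_has ha x z1)
  (zhasZ (-1) (comm_bounded_has hb x z1)).
rewrite hab// mulN1r subrr => /zhasE h.
rewrite (_ : (fun k => _) = (fun k => a k x * z ^ k + -1 * (b k x * z ^ k))).
  by rewrite h cnorm0.
by apply/funext => k; rewrite mulN1r mulrBl.
Qed.

Lemma comm_bounded_add a b M M' : comm_bounded a M -> comm_bounded b M' ->
  comm_bounded (fun n x => a n x + b n x) (M + M') /\
  forall x z, cnorm z = 1 ->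
  gelfand (fun n x => a n x + b n x) x z = gelfand a x z + gelfand b x z.
Proof.
move=> ha hb; have [ca sa fa] := ha; have [cb sb fb] := hb; split; first split.
- by move=> k; exact: ccontinuousD.
- apply: zbnd_le (zbndD sa sb) (lexx _) => k; apply: supnorm_le => // x.
  by apply: le_trans (cnormD _ _) (lerD _ _); [exact: cnorm_le_coef ha _ _|exact: cnorm_le_coef hb _ _].
- move=> n x; have [->|/fa //] := eqVneq (a n x) 0.
  by rewrite add0r => /fb.
move=> x z z1; rewrite /gelfand; under eq_fun do rewrite mulrDl.
exact: zhasE (zhasD (comm_bounded_has ha x z1) (comm_bounded_has hb x z1)).
Qed.

Lemma comm_bounded_cst (c : R[i]) : comm_bounded (l1emb (fun _ : X => c)) (cnorm c) /\
  forall x z, gelfand (l1emb (fun _ : X => c)) x z = c.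
Proof.
split; first split.
- by rewrite /l1emb => k; case: (k == 0); exact: ccontinuous_cst.
- pose A (k : int) : R := if k == 0 then cnorm c else 0.
  have A0 k : 0 <= A k by rewrite /A; case: ifP => // _; exact: cnorm_ge0.
  have : zbnd A (cnorm c).
    have <- : \sum_(k <- [:: 0]) A k = cnorm c by rewrite big_seq1 /A eqxx.
    by apply: zbnd_fin => // k; rewrite inE /A => /negbTE ->.
  move=> h; apply: zbnd_le h (lexx _) => k; apply: supnorm_le => // x.
  by rewrite /l1emb /A; case: ifP; rewrite ?cnorm0.
- by move=> n x; rewrite /l1emb; case: (eqVneq n 0) => [->|_] //; rewrite eqxx.
move=> x z; rewrite /gelfand; set u := fun _ => _.
rewrite (zhasE (@zhas1 _ u 0 _)) /u /l1emb ?eqxx ?expr0z ?mulr1// => k /negbTE ->.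
by rewrite mul0r.
Qed.

End Commutant.

(** * A Wiener-type inversion theorem for Gelfand transforms *)

Section WienerClass.
Variables (R : realType) (X : topologicalType) (s si : X -> X).
Hypotheses (cX : compact [set: X]) (hX : hausdorff_space X).
Hypotheses (X0 : [set: X] !=set0) (ssi : cancel s si) (sis : cancel si s).
Local Open Scope ring_scope.
Implicit Types (a b : elt R X) (F G H : X -> R[i] -> R[i]).

Local Notation comm_bounded := (comm_bounded s si).

(** Transforms of elements of norm at most [M]; norm estimates can then be carried out on functions
    of [(x, z)]. *)
Definition wiener F (M : R) := exists2 a, comm_bounded a M &
  forall x z, cnorm z = 1 -> gelfand a x z = F x z.

(** The norm bound is left existential because a better one is recovered from the degree and the sup
    norm. *)
Definition trigpoly F (m : nat) := exists a M, [/\ comm_bounded a M,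
  forall n x, (m < absz n)%N -> a n x = 0 &
  forall x z, cnorm z = 1 -> gelfand a x z = F x z].

Lemma wiener_ext F G M : (forall x z, cnorm z = 1 -> F x z = G x z) ->
  wiener F M -> wiener G M.
Proof. by move=> h [a ha ga]; exists a => // x z z1; rewrite ga// h. Qed.

Lemma wiener_le F M M' : M <= M' -> wiener F M -> wiener F M'.
Proof.
by move=> h [a [c b f] ga]; exists a => //; split => // N; exact: le_trans (b N) h.
Qed.

Lemma wiener_cst c : wiener (fun _ _ => c) (cnorm c).
Proof.
have [h g] := comm_bounded_cst s si X0 c.
by exists (l1emb (fun=> c)).
Qed.

Lemma wienerD F G M M' : wiener F M -> wiener G M' ->
  wiener (fun x z => F x z + G x z) (M + M').
Proof.
move=> [a ha ga] [b hb gb]; have [h g] := comm_bounded_add cX X0 ha hb.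
by eexists; [exact: h|move=> x z z1; rewrite g// ga// gb].
Qed.

Lemma wienerM F G M M' : wiener F M -> wiener G M' ->
  wiener (fun x z => F x z * G x z) (M * M').
Proof.
move=> [a ha ga] [b hb gb]; have [h g] := comm_bounded_mul cX X0 ssi sis ha hb.
by eexists; [exact: h|move=> x z z1; rewrite g// ga// gb].
Qed.

Lemma wienerX F M n : wiener F M -> wiener (fun x z => F x z ^+ n) (M ^+ n).
Proof.
move=> hF; elim: n => [|n IH]; first by rewrite expr0 -(cnorm1 R); exact: wiener_cst.
rewrite exprS; apply: wiener_ext (wienerM hF IH) => x z _.
by rewrite exprS.
Qed.

Lemma wiener_cnorm F M x z : wiener F M -> cnorm z = 1 -> cnorm (F x z) <= M.
Proof. by move=> [a ha ga] z1; rewrite -ga//; exact: (gelfand_le cX X0 ha). Qed.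

Lemma trigpoly1 : trigpoly (fun _ _ => 1) 0.
Proof.
have [h g] := comm_bounded_cst s si X0 (1 : R[i]).
exists (l1emb (fun=> 1)), (cnorm 1); split => // n x; rewrite /l1emb.
by case: eqP => // ->.
Qed.

Lemma trigpolyM F G m m' : trigpoly F m -> trigpoly G m' ->
  trigpoly (fun x z => F x z * G x z) (m + m').
Proof.
move=> [a [M [ha da ga]]] [b [M' [hb db gb]]].
have [h g] := comm_bounded_mul cX X0 ssi sis ha hb.
exists (l1mul s si a b), (M * M'); split => //; last first.
  by move=> x z z1; rewrite g// ga// gb.
move=> n x nm; rewrite /l1mul -[RHS](zhasE (@zhas0 R)).
congr zsumC; apply/funext => k; rewrite /alphak.
have [km|mk] := leqP (absz k) m; last by rewrite da// mul0r.
by rewrite db ?mulr0//; lia.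
Qed.

Lemma trigpolyX F m n : trigpoly F m -> trigpoly (fun x z => F x z ^+ n) (m * n).
Proof.
move=> hF; elim: n => [|n IH]; first by rewrite muln0; exact: trigpoly1.
rewrite mulnS (_ : (fun x z => _) = fun x z => F x z * F x z ^+ n).
  exact: trigpolyM.
by apply/funext => x; apply/funext => z; rewrite exprS.
Qed.

(* A trigonometric polynomial of degree [m] has at most [2 m + 1] nonzero
   coefficients, each bounded by its sup norm. *)
Lemma trigpoly_wiener F m C : 0 <= C ->
  (forall x z, cnorm z = 1 -> cnorm (F x z) <= C) ->
  trigpoly F m -> wiener F (m.+1.*2%:R * C).
Proof.
move=> C0 hC [a [M [ha da ga]]]; exists a => //; have [ca ba fa] := ha.
(* The window [[-(m + 1), m + 1)] contains all degrees from [-m] to [m]; its [2 m + 2] entries give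
   the constant. *)
split => //; pose A k := if k \in zint m.+1 then C else 0.
have A0 k : 0 <= A k by rewrite /A; case: ifP.
have : zbnd A (m.+1.*2%:R * C).
  have -> : m.+1.*2%:R * C = \sum_(k <- zint m.+1) A k.
    rewrite (eq_big_seq (fun _ => C)); last by move=> k km; rewrite /A km.
    by rewrite big_const_seq count_predT size_map size_iota iter_addr_0 mulr_natl.
  by apply: zbnd_fin => //; [exact: zint_uniq|move=> k /negbTE; rewrite /A => ->].
move=> h; apply: zbnd_le h (lexx _) => k; apply: supnorm_le => // x.
rewrite /A; case: ifPn => [_|]; last first.
  by rewrite mem_zint => km; rewrite da ?cnorm0//; lia.
by apply: (coef_le_gelfand cX X0 ha) => z z1; rewrite ga// hC.
Qed.

Lemma comm_bounded_restr a M M' (P : pred int) : comm_bounded a M ->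
  zbnd (fun k => if P k then supnorm (a k) else 0) M' ->
  comm_bounded (fun n x => if P n then a n x else 0) M'.
Proof.
move=> [ca ba fa] h; split.
- by move=> k; case: (P k) => //; exact: ccontinuous_cst.
- apply: zbnd_le h (lexx _) => k; apply: supnorm_le => // x.
  by case: (P k); [exact: cnorm_le_supnorm|rewrite cnorm0].
- by move=> n x; case: (P n) => [/fa//|]; rewrite eqxx.
Qed.

(** Truncate to a window outside which the coefficient norms sum to at most [e]. *)
Lemma wiener_split F M e : wiener F M -> 0 < e -> exists G H m,
  [/\ trigpoly G m, wiener H e &
  forall x z, cnorm z = 1 -> F x z = G x z + H x z].
Proof.
move=> [a ha ga] e0; have [ca ba fa] := ha.
have S0 k : 0 <= supnorm (a k) by exact: supnorm_ge0.
have [N hN] := zbnd_tail S0 ba e0.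
pose a1 : elt R X := fun n x => if n \in zint N then a n x else 0.
pose a2 : elt R X := fun n x => if n \notin zint N then a n x else 0.
have h1 : comm_bounded a1 M.
  by apply: comm_bounded_restr ha _; apply: zbnd_le ba (lexx _) => k; case: ifP.
have h2 : comm_bounded a2 e.
  apply: (comm_bounded_restr (P := fun n => n \notin zint N) ha).
  by apply: zbnd_le hN (lexx _) => k; rewrite /ztail; case: (k \in zint N).
have [_ g] := comm_bounded_add cX X0 h1 h2.
exists (gelfand a1), (gelfand a2), N; split.
- exists a1, M; split => // n x nN.
  by rewrite /a1 ifN// mem_zint; lia.
- by exists a2.
- move=> x z z1; rewrite -ga// -(g x z z1); congr gelfand.
  apply/funext => n; apply/funext => y; rewrite /a1 /a2.
  by case: ifP => _ /=; rewrite ?addr0 ?add0r.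
Qed.

(** With [F = G + H], use [F^(k+1) G^j = F^k G^(j+1) + H F^k G^j]; the extra factor [G^j] is what
    lets the induction on [k] close. Only [H] is measured in norm, while powers of [G] are measured
    by sup norm at the cost of a factor linear in the degree. *)
Lemma wiener_pow_split G H m th e : trigpoly G m -> wiener H e ->
  (forall x z, cnorm z = 1 -> cnorm (G x z) <= th) -> 0 <= th -> 0 <= e ->
  forall k j, wiener (fun x z => (G x z + H x z) ^+ k * G x z ^+ j)
    ((m * (j + k)).+1.*2%:R * (th ^+ j * (th + e) ^+ k)).
Proof.
move=> tG wH Gth th0 e0; elim=> [|k IH] j.
  rewrite addn0 expr0 mulr1.
  apply: (@wiener_ext (fun x z => G x z ^+ j)); first by move=> x z _; rewrite expr0 mul1r.
  apply: trigpoly_wiener; [exact: exprn_ge0| |exact: trigpolyX].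
  by move=> x z z1; rewrite cnormX lerXn2r ?nnegrE ?cnorm_ge0// Gth.
have := wienerD (IH j.+1) (wienerM wH (IH j)).
set c1 := _%:R; set c2 := _%:R => h.
(* [c2] is the constant for exponent sum [j + k] and [c1] the one for [j + k + 1]; the larger serves
   both terms. *)
have c21 : c2 <= c1 by rewrite ler_nat leq_double ltnS leq_mul2l; lia.
rewrite addnS -addSn -/c1.
apply: wiener_le (wiener_ext _ h); last by move=> x z _ /=; rewrite !exprS; ring.
have Q0 : 0 <= th ^+ j * (th + e) ^+ k by rewrite mulr_ge0 ?exprn_ge0 ?addr_ge0.
rewrite !exprS.
have -> : c1 * (th ^+ j * ((th + e) * (th + e) ^+ k)) =
  c1 * (th * th ^+ j * (th + e) ^+ k) + e * (c1 * (th ^+ j * (th + e) ^+ k)) by ring.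
by rewrite lerD2l ler_wpM2l// ler_wpM2r.
Qed.

(** Bernoulli's inequality gives [r ^ p * (p * h) <= 1] with [h = 1 - r]. The exponent [2 p] squares
    this decay, which then beats a factor linear in [p]. *)
Lemma subexponential_lt1 (m : nat) (r : R) : 0 <= r -> r < 1 ->
  exists n, (m * n).+1.*2%:R * r ^+ n < 1.
Proof.
move=> r0 r1; pose h := 1 - r.
have h0 : 0 < h by rewrite subr_gt0.
have bern p : r ^+ p * (1 + p%:R * h) <= 1.
  elim: p => [|p IH]; first by rewrite expr0 mul0r addr0 mulr1.
  rewrite exprSr -mulrA; apply: le_trans IH; rewrite ler_wpM2l ?exprn_ge0//.
  have p0 : 0 <= p%:R :> R by [].
  rewrite -[p.+1]addn1 natrD -/h (_ : r = 1 - h); last by rewrite /h; ring.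
  have := mulr_ge0 p0 (sqr_ge0 h); have := sqr_ge0 h; nra.
pose K : R := (m.*2.+1.*2)%:R.
(* With [K < p * h ^ 2], the estimate [Q * (p * h ^ 2) <= K] below forces [Q < 1]. *)
have [p hp] : exists p : nat, K / h ^+ 2 < p%:R.
  by exists (Num.truncn (K / h ^+ 2)).+1; rewrite truncnS_gt.
have hp1 : K < p%:R * h ^+ 2 by rewrite -ltr_pdivrMr ?exprn_gt0.
have K0 : 0 < K by rewrite ltr0n.
have p0 : (0 < p)%N.
  by case: p hp1 {hp} => //; rewrite mul0r => /(lt_trans K0); rewrite ltxx.
exists (p + p)%N; rewrite exprD; set w := r ^+ p.
have w0 : 0 <= w by exact: exprn_ge0.
have wp : w * p%:R * h <= 1.
  by have := bern p; rewrite -/w mulrDr mulr1 mulrA; lra.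
have cK : (m * (p + p)).+1.*2%:R <= K * p%:R.
  by rewrite /K -natrM ler_nat; nia.
have h1 : (m * (p + p)).+1.*2%:R * (w * w) <= K * p%:R * (w * w).
  by rewrite ler_wpM2r// mulr_ge0.
apply: le_lt_trans h1 _; set Q := K * p%:R * (w * w).
have Qh : Q * (p%:R * h ^+ 2) <= K.
  have -> : Q * (p%:R * h ^+ 2) = K * (w * p%:R * h) ^+ 2 by rewrite /Q; ring.
  by rewrite ger_pMr// exprn_ile1// (mulr_ge0 (mulr_ge0 w0 (ler0n _ _)) (ltW h0)).
rewrite ltNge; apply/negP => Q1.
have : p%:R * h ^+ 2 <= Q * (p%:R * h ^+ 2).
  by rewrite ler_peMl// mulr_ge0// sqr_ge0.
by move: Qh hp1; lra.
Qed.

(** The geometric series of powers of [F], extended by zero to negative indices so that the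
    two-sided series lemma applies. *)
Lemma wiener_neumann F q : wiener F q -> q < 1 ->
  exists M, wiener (fun x z => (1 - F x z)^-1) M.
Proof.
move=> wF q1; have q0 : 0 <= q by have [a ha _] := wF; exact: comm_bounded_ge0 ha.
have /choice[c hc] : forall n : nat, exists c : elt R X, comm_bounded c (q ^+ n) /\
    forall x z, cnorm z = 1 -> gelfand c x z = F x z ^+ n.
  by move=> n; have [c h g] := wienerX n wF; exists c.
pose d (k : int) : elt R X := if k is Posz n then c n else l1emb (fun=> 0).
pose B (k : int) : R := if k is Posz n then q ^+ n else 0.
have hd k : comm_bounded (d k) (B k).
  case: k => n /=; first by case: (hc n).
  by have [+ _] := comm_bounded_cst s si X0 (0 : R[i]); rewrite cnorm0.
have hB : zbnd B (1 - q)^-1.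
  (* The first [N] indices of the window are negative and contribute nothing; the others form a
     finite geometric sum. *)
  move=> N; rewrite /zpartial -addnn big_split_ord /= big1 ?add0r; last first.
    move=> j _; rewrite (_ : j%:Z - N%:Z = Negz (N - j).-1) //.
    by have := ltn_ord j; lia.
  rewrite (eq_bigr (fun j : 'I_N => q ^+ j)); last first.
    by move=> j _; rewrite PoszD addrAC subrr add0r.
  rewrite -[leRHS]mul1r ler_pdivlMr ?subr_gt0// mulrC.
  have := subrX1 q N; have := exprn_ge0 N q0; lra.
have [he ge] := comm_bounded_series cX X0 hd hB.
exists (1 - q)^-1; eexists; [exact: he|move=> x z z1; rewrite ge//].
pose u (k : int) := if k is Posz n then F x z ^+ n else 0.
have -> : (fun k => gelfand (d k) x z) = u.
  apply/funext => -[] n /=; first by case: (hc n) => _ ->.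
  by have [_ ->] := comm_bounded_cst s si X0 (0 : R[i]).
have fq : cnorm (F x z) <= q by exact: wiener_cnorm.
have hu : zhas u (zsumC u).
  apply: (@zsummable_has _ _ (1 - q)^-1); apply: zbnd_le hB (lexx _) => -[] n /=.
    by rewrite cnormX lerXn2r ?nnegrE ?cnorm_ge0.
  by rewrite cnorm0.
(* [u k = F * u (k - 1) + (k == 0)], so the sum [S] satisfies [S = F * S + 1]. *)
have h1 := zhasZ (F x z) (zhas_bij (subrK 1) (addrK 1) hu).
have h2 : zhas (fun k => if k == 0 then 1 else 0) (1 : R[i]).
  by apply: (@zhas1 _ (fun k => if k == 0 then 1 else 0) 0) => k /negbTE ->.
have := zhasE (zhasD h1 h2).
rewrite (_ : (fun k => _) = u) => [hS|]; last first.
  apply/funext => -[[|n]|n] /=; rewrite ?mulr0 ?add0r ?addr0//.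
  by rewrite subn1 exprS.
have h3 : (1 - F x z) * zsumC u = 1 by rewrite mulrBl mul1r {1}hS; ring.
have n0 : 1 - F x z != 0.
  by apply/eqP => h0; move: h3; rewrite h0 mul0r => /esym/eqP; rewrite oner_eq0.
by rewrite -[LHS](mulKf n0) h3 mulr1.
Qed.

(** The norm of [F] itself may exceed 1, but some power [F^n] has norm below 1. Then [(1 - F)^-1] is
    [(1 - F^n)^-1] times the sum of [F^j] for [j < n]. *)
Lemma wiener_inv F M rho : wiener F M -> rho < 1 ->
  (forall x z, cnorm z = 1 -> cnorm (F x z) <= rho) ->
  exists M', wiener (fun x z => (1 - F x z)^-1) M'.
Proof.
move=> wF rho1 hF.
have rho0 : 0 <= rho.
  by have [x _] := X0; apply: le_trans (hF x 1 (cnorm1 R)); exact: cnorm_ge0.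
(* The sup norm of [G] is at most [rho + e], so powers grow at rate
   [rho + 2 e = (1 + rho) / 2 < 1]. *)
pose e := (1 - rho) / 4; have e0 : 0 < e by rewrite divr_gt0// subr_gt0.
have [G [H [m [tG wH FE]]]] := wiener_split wF e0.
have Gth x z : cnorm z = 1 -> cnorm (G x z) <= rho + e.
  move=> z1; have -> : G x z = F x z - H x z by rewrite FE// addrK.
  apply: le_trans (cnormD _ _) _; rewrite cnormN lerD ?hF//.
  exact: wiener_cnorm.
have th0 : 0 <= rho + e by rewrite addr_ge0// ltW.
have r0 : 0 <= rho + e + e by rewrite addr_ge0// ltW.
have r1 : rho + e + e < 1 by rewrite /e; lra.
have [n hn] := subexponential_lt1 m r0 r1.
have := wiener_pow_split tG wH Gth th0 (ltW e0) n 0.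
rewrite add0n expr0 mul1r; set q := _ * _ => wq.
have {}wq : wiener (fun x z => F x z ^+ n) q.
  by apply: wiener_ext wq => x z z1; rewrite expr0 mulr1 FE.
have [M1 h1] := wiener_neumann wq hn.
have [M2 h2] : exists M2, wiener (fun x z => \sum_(j < n) F x z ^+ j) M2.
  elim: n {hn q wq h1} => [|n [M2 IH]].
    exists (cnorm 0); apply: wiener_ext (wiener_cst 0) => x z _.
    by rewrite big_ord0.
  exists (M2 + M ^+ n); apply: wiener_ext (wienerD IH (wienerX n wF)) => x z _.
  by rewrite big_ord_recr.
exists (M1 * M2); apply: wiener_ext (wienerM h1 h2) => x z z1.
have sub_neq0 (f : R[i]) (b : R) : cnorm f <= b -> b < 1 -> 1 - f != 0.
  move=> fb b1; apply/eqP => /eqP; rewrite subr_eq0 => /eqP f1.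
  by move: (le_lt_trans fb b1); rewrite -f1 cnorm1 ltxx.
have n1 := sub_neq0 _ _ (wiener_cnorm x wq z1) hn.
have n2 := sub_neq0 _ _ (hF x z z1) rho1.
apply: (mulfI n2); rewrite divff// mulrCA.
have -> : (1 - F x z) * (\sum_(j < n) F x z ^+ j) = 1 - F x z ^+ n.
  by rewrite -[RHS]opprB subrX1 -mulNr opprB.
by rewrite mulVf.
Qed.

End WienerClass.

(** * Maximal ideals, semisimplicity and real spectra *)

Section HermitianSemisimple.
Variables (R : realType) (X : topologicalType) (s si : X -> X).
Hypotheses (cX : compact [set: X]) (hX : hausdorff_space X).
Hypotheses (X0 : [set: X] !=set0) (ssi : cancel s si) (sis : cancel si s).
Local Open Scope ring_scope.
Implicit Types (a b : elt R X).

Local Notation comm_bounded := (comm_bounded s si).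
Local Notation commutant := (commutant s si).

Lemma comm_bounded_commutant a M : comm_bounded a M -> commutant a.
Proof. by move=> h; apply/commutantP => //; exists M. Qed.

Lemma gelfand_mul a b x z : commutant a -> commutant b -> cnorm z = 1 ->
  gelfand (l1mul s si a b) x z = gelfand a x z * gelfand b x z.
Proof.
move=> /(commutantP _ _ cX hX)[M ha] /(commutantP _ _ cX hX)[M' hb].
by have [_ g] := comm_bounded_mul cX X0 ssi sis ha hb; exact: g.
Qed.

Lemma gelfand_add a b x z : commutant a -> commutant b -> cnorm z = 1 ->
  gelfand (fun n x => a n x + b n x) x z = gelfand a x z + gelfand b x z.
Proof.
move=> /(commutantP _ _ cX hX)[M ha] /(commutantP _ _ cX hX)[M' hb].
by have [_ g] := comm_bounded_add cX X0 ha hb; exact: g.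
Qed.

Lemma gelfand_cst (c : R[i]) x z : gelfand (l1emb (fun _ : X => c)) x z = c.
Proof. by have [_ ->] := comm_bounded_cst s si X0 c. Qed.

Lemma commutant_mul a b : commutant a -> commutant b -> commutant (l1mul s si a b).
Proof.
move=> /(commutantP _ _ cX hX)[M ha] /(commutantP _ _ cX hX)[M' hb].
by have [h _] := comm_bounded_mul cX X0 ssi sis ha hb; exact: comm_bounded_commutant h.
Qed.

Lemma commutant_add a b : commutant a -> commutant b ->
  commutant (fun n x => a n x + b n x).
Proof.
move=> /(commutantP _ _ cX hX)[M ha] /(commutantP _ _ cX hX)[M' hb].
by have [h _] := comm_bounded_add cX X0 ha hb; exact: comm_bounded_commutant h.
Qed.

Lemma commutant_cst (c : R[i]) : commutant (l1emb (fun _ : X => c)).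
Proof.
by have [h _] := comm_bounded_cst s si X0 c; exact: comm_bounded_commutant h.
Qed.

Lemma commutant_gelfand_inj a b : commutant a -> commutant b ->
  (forall x z, cnorm z = 1 -> gelfand a x z = gelfand b x z) -> a = b.
Proof.
move=> /(commutantP _ _ cX hX)[M ha] /(commutantP _ _ cX hX)[M' hb].
exact: (gelfand_inj cX X0 ha hb).
Qed.

Lemma l1oneE : @l1one R X = l1emb (fun=> 1).
Proof. by []. Qed.

Lemma l1zeroE : @l1zero R X = l1emb (fun=> 0).
Proof. by apply/funext => n; apply/funext => x; rewrite /l1emb if_same. Qed.

(** Subtracting a scalar becomes adding a constant element, to which additivity of the transform
    applies. *)
Lemma l1subscE a l : l1subsc a l = fun n x => a n x + l1emb (fun=> - l) n x.
Proof.
apply/funext => n; apply/funext => x; rewrite /l1subsc /l1one /l1emb.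
by case: ifP => _; rewrite ?mulr1 ?mulr0 ?oppr0.
Qed.

(** If a proper ideal [J] contains the kernel and some [b] in [J] has value [c != 0], then [b - c]
    lies in the kernel, and [c^-1 b - c^-1 (b - c) = 1] puts the unit in [J]. *)
Lemma gelfand_kernel_maximal (x : X) (z : R[i]) : cnorm z = 1 ->
  comm_maximal_ideal s si [set a : elt R X | commutant a /\ gelfand a x z = 0].
Proof.
move=> z1; split.
  split; first by move=> a [].
  split; first by rewrite l1zeroE; split; [exact: commutant_cst|exact: gelfand_cst].
  split.
    move=> a b [ca ga] [cb gb]; split; first exact: commutant_add.
    by rewrite gelfand_add// ga gb addr0.
  split.
    move=> a b [ca ga] cb; split; split; rewrite ?gelfand_mul ?ga ?mulr0 ?mul0r//;
      exact: commutant_mul.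
  by move=> [_]; rewrite l1oneE gelfand_cst => /eqP; rewrite oner_eq0.
move=> J [JC [J0 [JD [JM J1]]]] IJ; apply/seteqP; split => // b Jb.
have cb := JC b Jb; split => //; apply: contrapT => /eqP gb; apply: J1.
set c := gelfand b x z in gb.
have cc := commutant_cst c^-1; have cmc := commutant_cst (- c^-1).
have csub : commutant (l1subsc b c).
  by rewrite l1subscE; apply: commutant_add => //; exact: commutant_cst.
have gsub y w : cnorm w = 1 -> gelfand (l1subsc b c) y w = gelfand b y w - c.
  by move=> w1; rewrite l1subscE gelfand_add ?gelfand_cst//; exact: commutant_cst.
have Jsub : J (l1subsc b c) by apply: IJ; split => //; rewrite gsub// subrr.
have [Jl _] := JM _ _ Jb cc; have [Jr _] := JM _ _ Jsub cmc.
rewrite (_ : @l1one R X = fun n y => l1mul s si (l1emb (fun=> c^-1)) b n y +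
  l1mul s si (l1emb (fun=> - c^-1)) (l1subsc b c) n y); first exact: JD.
have cl := commutant_mul cc cb; have cr := commutant_mul cmc csub.
apply: commutant_gelfand_inj; first exact: commutant_cst.
  exact: commutant_add.
move=> y w w1; rewrite l1oneE gelfand_cst gelfand_add// !gelfand_mul// !gelfand_cst gsub//.
by field.
Qed.

Lemma comm_semisimple : @semisimple_comm R X s si.
Proof.
move=> a [ca h] /=; rewrite l1zeroE; apply: commutant_gelfand_inj => //.
  exact: commutant_cst.
move=> x z z1; rewrite gelfand_cst.
by have [] := h _ (gelfand_kernel_maximal x z1).
Qed.

Lemma conjc_expz (z : R[i]) (n : int) : cnorm z = 1 -> conjc (z ^ (- n)) = z ^ n.
Proof.
move=> z1; have z0 := cnorm1_neq0 z1.
have zV : conjc z = z^-1.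
  apply: (mulfI z0); rewrite divff//; move: z1; rewrite /cnorm; case: z {z0} => p q /= h.
  have {h} : p ^+ 2 + q ^+ 2 = 1.
    by rewrite -[LHS]sqr_sqrtr ?h ?expr1n// addr_ge0// sqr_ge0.
  by move=> h; apply/eqP; rewrite eq_complex /=; apply/andP; split; apply/eqP; lra.
by rewrite rmorphXz ?unitfE//= zV exprz_inv opprK.
Qed.

(** Self-adjointness makes the coefficient at [- n] conjugate to the one at [n], so conjugating the
    series and substituting [- n] for [n] gives it back. *)
Lemma gelfand_selfadjoint_real a x z : commutant a -> l1star s si a = a ->
  cnorm z = 1 -> complex.Im (gelfand a x z) = 0.
Proof.
move=> /(commutantP _ _ cX hX)[M ha] aa z1; have [_ _ fa] := ha.
have starE n : conjc (a (- n) x) = a n x.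
  have := congr1 (fun e => e n x) aa; rewrite /l1star /alphak => <-.
  (* If [x] is not fixed by the iterate [- n], neither is its image under that iterate, so the
     coefficient at [- n] vanishes at both points. *)
  have [fx|nfx] := pselect (zit s si (- n) x = x); first by rewrite fx.
  have e0 y : zit s si (- n) y = y \/ a (- n) y = 0.
    have [->|/fa] := eqVneq (a (- n) y) 0; first by right.
    by move=> /(zit_fixN ssi sis); rewrite opprK; left.
  have [//|->] := e0 x.
  have [h|-> //] := e0 (zit s si (- n) x).
  have K y : zit s si n (zit s si (- n) y) = y by rewrite -zitD// addrN.
  by case: nfx; have := congr1 (zit s si n) h; rewrite !K.
have h := comm_bounded_has cX X0 ha x z1.
have := zhasE (zhas_bij opprK opprK (zhas_conj h)).
rewrite (_ : (_ \o _) = fun n => a n x * z ^ n); last first.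
  by apply/funext => n /=; rewrite rmorphM /= starE conjc_expz.
rewrite -/(gelfand a x z); case: (gelfand a x z) => p q [] /=.
by move=> /eqP; rewrite -subr_eq0 opprK -mulr2n mulrn_eq0 => /eqP.
Qed.

(* Move the centre of a disc away from [l] along the imaginary direction: for
   [mu = Re l - i t Im l] with [t] large, all values of the real Gelfand
   transform lie closer to [mu] than [l] does. *)
Lemma comm_hermitian : @hermitian_comm R X s si.
Proof.
move=> a ca aa l hl; apply: contrapT => /eqP q0; apply: hl.
have /(commutantP _ _ cX hX)[M ha] := ca.
have M0 := comm_bounded_ge0 ha.
case: l q0 => p q /= q0; set l := Complex p q.
have q2 : 0 < q ^+ 2 by rewrite exprn_even_gt0.
(* [K] bounds the distance from the transform to [p]. The choice of [t] makes the cross term of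
   [(q + t * q) ^ 2] equal to [2 K^2], which exceeds the [K^2] needed. *)
pose K := M + `|p|; have K0 : 0 <= K by rewrite addr_ge0.
pose t := K ^+ 2 / q ^+ 2; have t0 : 0 <= t by rewrite divr_ge0 ?sqr_ge0.
have tq : t * q ^+ 2 = K ^+ 2 by rewrite divfK// gt_eqF.
pose mu : R[i] := Complex p (- (t * q)).
pose D := cnorm (l - mu); pose r := Num.sqrt (K ^+ 2 + (t * q) ^+ 2).
have rD : r < D.
  have -> : D = Num.sqrt ((q + t * q) ^+ 2).
    by rewrite /D /cnorm /= subrr opprK expr0n add0r.
  have h1 : K ^+ 2 + (t * q) ^+ 2 < (q + t * q) ^+ 2.
    have -> : (q + t * q) ^+ 2 = q ^+ 2 + 2 * (t * q ^+ 2) + (t * q) ^+ 2 by ring.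
    by rewrite tq ltrD2r; have := sqr_ge0 K; move: q2; lra.
  by rewrite ltr_sqrt//; apply: le_lt_trans h1; rewrite addr_ge0 ?sqr_ge0.
have D0 : 0 < D by apply: le_lt_trans rD; exact: sqrtr_ge0.
have lmu : l - mu != 0.
  by apply/eqP => h; move: D0; rewrite /D h cnorm0 ltxx.
have ga x z : cnorm z = 1 -> cnorm (gelfand a x z - mu) <= r.
  move=> z1; have := gelfand_selfadjoint_real x ca aa z1.
  have := gelfand_le cX X0 ha x z1.
  case: (gelfand a x z) => y w /= + w0; rewrite w0 => yM.
  have yM' : `|y| <= M by apply: le_trans yM; exact: (ler_norm_Re (Complex y 0)).
  rewrite /cnorm /= opprK add0r ler_wsqrtr// lerD2r -real_normK ?num_real//.
  rewrite lerXn2r ?nnegrE//; apply: le_trans (ler_normB _ _) _.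
  by rewrite lerD2r.
pose F x z := (gelfand a x z - mu) / (l - mu).
have wa : wiener s si (gelfand a) M by exists a.
have wF := wienerM cX X0 ssi sis (wienerD cX X0 wa (wiener_cst s si X0 (- mu)))
  (wiener_cst s si X0 (l - mu)^-1).
have Frho x z : cnorm z = 1 -> cnorm (F x z) <= r / D.
  by move=> z1; rewrite /F cnormM cnormV ler_pM2r ?invr_gt0// ga.
have rD1 : r / D < 1 by rewrite ltr_pdivrMr// mul1r.
have [M' wI] := wiener_inv cX X0 ssi sis wF rD1 Frho.
(* Since [a - l = - (l - mu) (1 - F)], this [b] has the reciprocal transform. *)
have [b hb gb] := wienerM cX X0 ssi sis (wiener_cst s si X0 (- (l - mu)^-1)) wI.
have cb := comm_bounded_commutant hb.
have csub : commutant (l1subsc a l).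
  by rewrite l1subscE; apply: commutant_add => //; exact: commutant_cst.
have inv x z : cnorm z = 1 -> gelfand (l1subsc a l) x z * gelfand b x z = 1.
  move=> z1; rewrite l1subscE gelfand_add//; last exact: commutant_cst.
  rewrite gelfand_cst gb//.
  have n2 : 1 - F x z != 0.
    apply/eqP => /eqP; rewrite subr_eq0 => /eqP F1.
    by have := le_lt_trans (Frho x z z1) rD1; rewrite -F1 cnorm1 ltxx.
  have -> : gelfand a x z + - l = - ((l - mu) * (1 - F x z)).
    by rewrite mulrBr mulr1 /F mulrC divfK//; ring.
  by rewrite -/(F x z) !mulNr mulrN opprK mulrACA !divff// mul1r.
exists b; split => //; rewrite l1oneE; split.
  apply: commutant_gelfand_inj; [exact: commutant_mul|exact: commutant_cst|].
  by move=> x z z1; rewrite gelfand_mul// inv// gelfand_cst.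
apply: commutant_gelfand_inj; [exact: commutant_mul|exact: commutant_cst|].
by move=> x z z1; rewrite gelfand_mul// mulrC inv// gelfand_cst.
Qed.

End HermitianSemisimple.

Theorem theorem3p9 (R : realType) (X : topologicalType) (s si : X -> X) :
  compact [set: X] -> hausdorff_space X -> [set: X] !=set0 ->
  continuous s -> continuous si -> cancel s si -> cancel si s ->
  @hermitian_comm R X s si /\ @semisimple_comm R X s si.
Proof.
move=> cX hX X0 _ _ ssi sis; split.
  exact: comm_hermitian.
exact: comm_semisimple.
Qed.
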